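(* Let $G_1,G_2$ be graphs, let $g_k\in V(G_1)$ be a vertex that is not a dominating vertex of $G_1$, and let $\psi\in\mathrm{Aut}(G_2)$ be a non-identity automorphism. Define $\lambda:V(G_1*G_2)\to V(G_1*G_2)$ by $\lambda(g_k,b)=(g_k,\psi(b))$ for all $b\in V(G_2)$, and $\lambda(a,b)=(a,b)$ for all $a\in V(G_1)\setminus\{g_k\}$, $b\in V(G_2)$. Then $\lambda$ is an automorphism of $G_1*G_2$ if and only if for every vertex $b\in V(G_2)$ we have $N_{G_2}(b)=N_{G_2}(\psi(b))$ (i.e. every vertex moved by $\psi$ and its image are false twins in $G_2$).
   Context: All graphs are finite and simple. For graphs $G_1,G_2$, the co-normal product $G_1*G_2$ is the graph with vertex set $V(G_1)\times V(G_2)$ in which $(a,b)$ and $(c,d)$ are adjacent if and only if $a$ is adjacent to $c$ in $G_1$ or $b$ is adjacent to $d$ in $G_2$. A dominating vertex of a graph $G$ is a vertex of degree $|V(G)|-1$. $N_G(v)$ is the open neighborhood of $v$. Two distinct vertices $u,v$ are false twins if $N(u)=N(v)$. *)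

(* Defs.v *)
From mathcomp Require Import all_boot.

Set Implicit Arguments.
Unset Strict Implicit.
Unset Printing Implicit Defensive.

Record sgraph := SGraph {
  vertex :> finType;
  adj : rel vertex;
  adj_sym : symmetric adj;
  adj_irrefl : irreflexive adj
}.

Arguments adj {G} : rename.

Definition nbhd (G : sgraph) (v : G) : {set G} := [set u | adj v u].

Definition degree (G : sgraph) (v : G) : nat := #|nbhd v|.

Definition dominating (G : sgraph) (v : G) : bool := degree v == #|G|.-1.

Definition is_automorphism (G : sgraph) (f : G -> G) : Prop :=
  bijective f /\ forall x y : G, adj (f x) (f y) = adj x y.

Section ConormalProduct.

Variables G1 G2 : sgraph.

Definition conormal_adj : rel (G1 * G2) :=
  fun x y => adj x.1 y.1 || adj x.2 y.2.

Fact conormal_adj_sym : symmetric conormal_adj.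
Proof. by move=> x y; rewrite /conormal_adj (adj_sym x.1) (adj_sym x.2). Qed.

Fact conormal_adj_irrefl : irreflexive conormal_adj.
Proof. by move=> x; rewrite /conormal_adj !adj_irrefl. Qed.

Definition conormal : sgraph := SGraph conormal_adj_sym conormal_adj_irrefl.

Definition fiber_map (g : G1) (psi : G2 -> G2) : conormal -> conormal :=
  fun x : G1 * G2 => if x.1 == g then (g, psi x.2) else x.

End ConormalProduct.

(* Main.v *)
(** A vertex [g] that is not dominating has a non-neighbour [a] distinct from
    it.  Between the fibres over [g] and [a], adjacency in the co-normal product
    is adjacency in the second factor, and the fibre map moves only the first of
    the two fibres: preserving these adjacencies means that [psi] preserves
    neighbourhoods. *)
Require Import Defs.
From mathcomp Require Import all_boot.

(** Otherwise, by irreflexivity, the neighbourhood of [g] would be exactly the complement of [g],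
    which has [#|G|.-1] elements. *)
Lemma nondominating_nonadj (G : sgraph) (g : G) :
  ~~ dominating g -> exists2 a : G, a != g & ~~ adj g a.
Proof.
move=> g_nondom; apply/exists_inP; apply: contraNT g_nondom => no_nonadj.
rewrite /dominating /degree -(cardsC1 g); apply/eqP/eq_card => u.
rewrite !inE; have [-> | u_neq_g] := eqVneq u g; first exact: adj_irrefl.
by apply: contraNT no_nonadj => gNu; apply/exists_inP; exists u.
Qed.

Lemma fiber_map_cancel (G1 G2 : sgraph) (g : G1) (f h : G2 -> G2) :
  cancel f h -> cancel (fiber_map g f) (fiber_map g h).
Proof.
move=> fK [a b]; rewrite /fiber_map /=.
by have [-> | /negbTE a_neq_g] := eqVneq a g; rewrite /= ?eqxx ?fK ?a_neq_g.
Qed.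

Theorem theorem2p10 (G1 G2 : sgraph) (gk : G1) (psi : G2 -> G2)
    (gk_nondom : ~~ dominating gk)
    (psi_aut : is_automorphism psi)
    (psi_nonid : ~ (forall b : G2, psi b = b)) :
  is_automorphism (fiber_map gk psi) <->
  (forall b : G2, nbhd b = nbhd (psi b)).
Proof.
case: psi_aut => [[phi psiK phiK] psi_adj]; split=> [[_ lam_adj] b | psi_nbhd].
  have [a /negbTE a_neq_gk /negbTE gkNa] := nondominating_nonadj _ _ gk_nondom.
  apply/setP=> c; rewrite !inE; have := lam_adj (gk, b) (a, c).
  by rewrite /fiber_map /= eqxx a_neq_gk /= /conormal_adj /= gkNa.
have adj_psi b c : adj (psi b) c = adj b c.
  by have /setP/(_ c) := psi_nbhd b; rewrite !inE.
split; first by exists (fiber_map gk phi); exact: fiber_map_cancel.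
move=> [a b] [c d]; rewrite /fiber_map /= /conormal_adj.
(* If both vertices lie over [gk], both second coordinates move and [psi_adj] applies; if only one
   does, the equality of neighbourhoods is needed; otherwise nothing moves. *)
have [-> | _] := eqVneq a gk; have [-> | _] := eqVneq c gk => //=.
- by rewrite psi_adj.
- by rewrite adj_psi.
(* Symmetry brings [psi d] into the first argument, where [adj_psi] applies. *)
- by rewrite adj_sym (adj_sym b) adj_psi (adj_sym d) (adj_sym b).
Qed.
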